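(* Let $n\ge 3$ and let $p,q$ be different points in $Q^{n-1}=\mathbb{R}^n/\mathbb{R}(1,\ldots,1)$ having representatives $p',q'\in\mathbb{R}^n$ whose coordinates are, respectively, the first and second columns of a normal idempotent matrix $A=(a_{ij})\in\mathbb{R}^{n\times n}$. For $1\le k<l\le n$ let $f_{kl}=a_{k1}+a_{l2}-a_{k2}-a_{l1}$, and let $F=(f_{kl})_{1\le k<l\le n}$ and $|F|=(|f_{kl}|)_{1\le k<l\le n}$. Let $L(p,q)$ be the stable tropical line through $p$ and $q$. Then: 1. $L(p,q)$ is a balanced unrooted semi-labeled tree on $n$ leaves, it is caterpillar, and it is described by the matrix $F$ (that is, the combinatorial semi-labeled tree $L(p,q)$ is determined by $F$). 2. Every vertex of $L(p,q)$ belongs to the tropical segment $\operatorname{tconv}(p,q)$. 3. The vertex $pq$ of $L(p,q)$ closest to $p$ and the vertex $qp$ of $L(p,q)$ closest to $q$ (with respect to the tropical distance $\operatorname{d}$) exist. 4. The tropical distance between any pair of adjacent vertices of $L(p,q)$, and each of the distances $\operatorname{d}(p,pq)$, $\operatorname{d}(qp,q)$ and $\operatorname{d}(p,q)$, is an entry of the matrix $|F|$, i.e. equals $|f_{kl}|$ for some $1\le k<l\le n$. 5. If, in addition, $p$ and $q$ are generic, then the tree $L(p,q)$ is trivalent.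
   Context: Notation: $[n]=\{1,\ldots,n\}$; $\oplus=\max$ and $\odot=+$; tropical matrix product uses these operations. A matrix $A=(a_{ij})\in\mathbb{R}^{n\times n}$ is normal if $a_{ii}=0$ and $a_{ij}\le 0$ for all $i,j$; it is idempotent if $A\odot A=A$. Equivalently, $A$ is normal idempotent (NI) iff $a_{ii}=0$, $a_{ij}\le 0$ and $a_{ik}+a_{kj}\le a_{ij}$ for all $i,j,k\in[n]$. $Q^{n-1}$ is the quotient of $\mathbb{R}^n$ by classical addition of multiples of $(1,\ldots,1)$. Each class has a unique representative with last coordinate $0$, so $Q^{n-1}$ is identified with $H_n=\{x\in\mathbb{R}^n: x_n=0\}\cong\mathbb{R}^{n-1}$. Tropical distance: for $p,q\in Q^{n-1}$, with representatives having last coordinate $0$, $\operatorname{d}(p,q)=\max_{i,j\in[n]}\{|p_i-q_i|,\ |p_i-q_i-p_j+q_j|\}$. Tropical segment: for $p\ne q$ with representatives $p',q'$, $\operatorname{tconv}(p,q)$ is the union of $\{p,q\}$ with the image in $Q^{n-1}$ of $\{\lambda\odot p'\oplus\mu\odot q':\lambda,\mu\in\mathbb{R}\}$, where $(\lambda\odot p'\oplus\mu\odot q')_i=\max\{\lambda+p'_i,\mu+q'_i\}$ (the points $p,q$ are themselves of this form). Stable tropical line: for $p\neq q$, $L(p,q)$ is the unique tropical line through $p$ and $q$ that is stable under small perturbations (the limit of the tropical lines through generic small perturbations of $p$ and $q$). Explicitly, with $m_{ab}=\max\{p_a+q_b,\,p_b+q_a\}$, $L(p,q)$ is the set of $x\in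 Q^{n-1}$ such that, for all $1\le a<b<c\le n$, the maximum $\max\{x_a+m_{bc},\,x_b+m_{ac},\,x_c+m_{ab}\}$ is attained at least twice. As a polyhedral complex in $H_n\cong\mathbb{R}^{n-1}$, a tropical line is a tree consisting of $n$ unbounded rays $r_1,\dots,r_n$ and finitely many bounded edges; $r_j$ points in the direction $-e_j$ for $j\in[n-1]$ and $r_n$ in the direction $e_1+\cdots+e_{n-1}$ (the class of $-e_n$). The leaf marked $j$ of the tree is the ray $r_j$. ''Vertex'' means an inner vertex (a point where at least three rays or edges meet); inner vertices are unlabeled (''semi-labeled''). Two vertices are adjacent if they are the endpoints of a bounded edge. ''Balanced'' means that at each vertex the sum of the primitive integer direction vectors of the outgoing edges and rays is zero. The combinatorial semi-labeled tree is given by the family of bipartitions of $[n]$ induced by its inner edges (each inner edge separates the leaf labels into two sets). A tree is caterpillar if it contains a path passing through every vertex of degree $\ge 2$; it is trivalent if every inner vertex has degree $3$. ''Generic'' means: the pair $(p,q)$ lies outside a suitable finite union (depending only on $n$) of proper classical linear subspaces of the real vector space $Q^{n-1}\times Q^{n-1}$. *)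

(* Defs.v *)
From HB Require Import structures.
From mathcomp Require Import all_boot all_order all_algebra.
From mathcomp Require Import all_classical reals.

Set Implicit Arguments.
Unset Strict Implicit.
Unset Printing Implicit Defensive.

Import Order.TTheory GRing.Theory Num.Theory.
Local Open Scope ring_scope.

(* R^n / R(1, ..., 1), with the class of (x_1, ..., x_n), x_n = 0, encoded by
   the vector (x_1, ..., x_(n-1)). *)
Notation tpoint R n := 'cV[R]_n.-1.

(* The representative with last coordinate 0. *)
Definition rep (R : realType) (n : nat) (x : tpoint R n) : 'cV[R]_n :=
  \col_(i < n) if (insub (i : nat) : option 'I_n.-1) is Some j
               then x j 0 else 0.

Definition represents (R : realType) (n : nat) (y : 'cV[R]_n)
    (x : tpoint R n) : Prop :=
  exists c : R, forall i : 'I_n, y i 0 = rep x i 0 + c.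

(* (A (.) A)_ij = max_k (a_ik + a_kj).  The seed of the iterated maximum is the
   term k = i, so it does not affect the value. *)
Definition trop_square (R : realType) (n : nat) (A : 'M[R]_n) : 'M[R]_n :=
  \matrix_(i, j) \big[Num.max/A i i + A i j]_(k < n) (A i k + A k j).

Definition normal_mx (R : realType) (n : nat) (A : 'M[R]_n) : Prop :=
  (forall i, A i i = 0) /\ (forall i j, A i j <= 0).

Definition normal_idempotent (R : realType) (n : nat) (A : 'M[R]_n) : Prop :=
  normal_mx A /\ trop_square A = A.

(* Entries on and below the diagonal are not part of the data and are 0. *)
Definition Fmx (R : realType) (n : nat) (c1 c2 : 'I_n) (A : 'M[R]_n) : 'M[R]_n :=
  \matrix_(k, l) if (k < l)%N then A k c1 + A l c2 - A k c2 - A l c1 else 0.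

Definition entry_of_abs (R : realType) (n : nat) (F : 'M[R]_n) (r : R) : Prop :=
  exists k l : 'I_n, (k < l)%N /\ r = `|F k l|.

Definition tdist (R : realType) (n : nat) (p q : tpoint R n) : R :=
  \big[Num.max/0]_(i < n) \big[Num.max/0]_(j < n)
    Num.max `|rep p i 0 - rep q i 0|
            `|rep p i 0 - rep q i 0 - rep p j 0 + rep q j 0|.

Definition tcomb (R : realType) (n : nat) (lam mu : R) (y z : 'cV[R]_n) :
    'cV[R]_n :=
  \col_i Num.max (lam + y i 0) (mu + z i 0).

Definition max_attained_twice (R : realType) (a b c : R) : Prop :=
  let m := Num.max a (Num.max b c) in
  (2 <= count (pred1 m) [:: a; b; c])%N.

(* A combinatorial tree with n labelled leaves, whose inner vertices are placed
   at points of R^(n-1): [tadj] is the adjacency by bounded edges, and the leaf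
   j (an unbounded ray) is attached to the inner vertex [tleaf j]. *)
Record embedded_tree (R : realType) (n : nat) := EmbeddedTree {
  tvert : finType;
  tpos  : tvert -> tpoint R n;
  tadj  : rel tvert;
  tleaf : 'I_n -> tvert
}.

Section Combinatorics.
Variables (R : realType) (n : nat) (T : embedded_tree R n).

Definition tnode : finType := (tvert T + 'I_n)%type.

Definition tree_rel : rel tnode := fun x y =>
  match x, y with
  | inl u, inl v => tadj u v
  | inl u, inr j | inr j, inl u => tleaf T j == u
  | inr _, inr _ => false
  end.

Definition degree (x : tnode) : nat := #|[pred y | tree_rel x y]|.

Definition is_tree : Prop :=
  [/\ symmetric tree_rel, irreflexive tree_rel,
      (forall x y, connect tree_rel x y)
    & (forall s : seq tnode, ucycle tree_rel s -> (size s <= 2)%N)].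

Definition caterpillar : Prop :=
  exists (x : tnode) (s : seq tnode),
    [/\ path tree_rel x s, uniq (x :: s)
      & forall y, (2 <= degree y)%N -> y \in x :: s].

Definition trivalent : Prop := forall u : tvert T, degree (inl u) = 3%N.

Definition del_edge (u v : tvert T) : rel (tvert T) := fun x y =>
  tadj x y && ((x, y) != (u, v)) && ((x, y) != (v, u)).

Definition side (u v : tvert T) : {set 'I_n} :=
  [set j | connect (del_edge u v) u (tleaf T j)]%SET.

(* The bipartitions {S, [n] \ S} induced by the inner edges. *)
Definition splits : {set {set {set 'I_n}}} :=
  [set [set side e.1 e.2; ~: side e.1 e.2]%SET
     | e : tvert T * tvert T & tadj e.1 e.2]%SET.

End Combinatorics.

Local Open Scope classical_set_scope.

Definition tconv (R : realType) (n : nat) (p q : tpoint R n) :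
    set (tpoint R n) :=
  [set p; q] `|`
  [set x | exists lam mu : R, represents (tcomb lam mu (rep p) (rep q)) x].

Definition stable_line (R : realType) (n : nat) (p q : tpoint R n) :
    set (tpoint R n) :=
  let m (a b : 'I_n) := Num.max (rep p a 0 + rep q b 0)
                                (rep p b 0 + rep q a 0) in
  [set x | forall a b c : 'I_n, (a < b)%N -> (b < c)%N ->
     max_attained_twice (rep x a 0 + m b c) (rep x b 0 + m a c)
                        (rep x c 0 + m a b)].

(* The class of the vector - e_j of R^n. *)
Definition ray_dir (R : realType) (n : nat) (j : 'I_n) : tpoint R n :=
  \col_(i < n.-1) if j.+1 == n then 1 else - (i == j :> nat)%:R.

Definition open_segment (R : realType) (n : nat) (x y : tpoint R n) :
    set (tpoint R n) :=
  [set (1 - t) *: x + t *: y | t in [set t : R | 0 < t < 1]].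

Definition open_ray (R : realType) (n : nat) (x d : tpoint R n) :
    set (tpoint R n) :=
  [set x + t *: d | t in [set t : R | 0 < t]].

Section Geometry.
Variables (R : realType) (n : nat) (T : embedded_tree R n).

(* The relative interiors of the cells: vertices, bounded edges and rays. *)
Definition open_cells : set (set (tpoint R n)) :=
  [set [set tpos u] | u in [set: tvert T]] `|`
  [set open_segment (tpos e.1) (tpos e.2)
     | e in [set e : tvert T * tvert T | tadj e.1 e.2]] `|`
  [set open_ray (tpos (tleaf T j)) (ray_dir R j) | j in [set: 'I_n]].

(* L, as a polyhedral complex, is the tree T: the cells of T meet along common
   faces only (i.e. their relative interiors are pairwise disjoint), their union
   is L, and at least three edges or rays meet at each vertex.  These conditions
   determine T from L, up to renaming the inner vertices. *)
Definition tree_structure (L : set (tpoint R n)) : Prop :=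
  [/\ is_tree T,
      (forall u : tvert T, (3 <= degree (T := T) (inl u))%N),
      injective (@tpos R n T),
      (forall X Y, open_cells X -> open_cells Y -> X `&` Y !=set0 -> X = Y)
    & \bigcup_(X in open_cells) X = L].

Definition primitive_along (d : tpoint R n) (z : 'cV[int]_n.-1) : Prop :=
  \big[gcdn/0%N]_(i < n.-1) `|z i 0%R|%N = 1%N /\
  exists2 c : R, 0 < c & d = c *: map_mx intr z.

Definition balanced : Prop :=
  forall u : tvert T,
  exists (ze : tvert T -> 'cV[int]_n.-1) (zr : 'I_n -> 'cV[int]_n.-1),
    [/\ forall v, tadj u v -> primitive_along (tpos v - tpos u) (ze v),
        forall j, tleaf T j = u -> primitive_along (ray_dir R j) (zr j)
      & \sum_(v | tadj u v) ze v + \sum_(j | tleaf T j == u) zr j = 0].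

Definition closest_vertex (x : tpoint R n) (v : tvert T) : Prop :=
  forall w : tvert T, tdist x (tpos v) <= tdist x (tpos w).

End Geometry.

(* Main.v *)
Require Import Defs.
From HB Require Import structures.
From mathcomp Require Import all_boot all_order all_algebra.
From mathcomp Require Import all_classical reals.
From mathcomp Require Import zify lra ring.

Set Implicit Arguments.
Unset Strict Implicit.
Unset Printing Implicit Defensive.

Import Order.TTheory GRing.Theory Num.Theory.
Local Open Scope ring_scope.

(** Up to an additive constant let [h] be the coordinatewise difference of [p]
   and [q]. The entries of [F] are the differences of values of [h]. For a
   normal idempotent matrix the inequalities [a_ik + a_kj <= a_ij] with
   [{k, j} = {1, 2}] say that [h] is largest at the coordinate 1 and smallest at
   the coordinate 2.

   In coordinates relative to [q] the tropical segment is the path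
   [r |-> max(h, r)] modulo [(1, ..., 1)], from the class of [h], which is [p],
   to the class of [0], which is [q]. The line consists of the part of this path
   with [r] between the smallest and the largest value of [h] on the coordinates
   other than 1 and 2, together with a ray [- e_j] that leaves the path at
   [r = h_j] for [j] other than 1 and 2, at the upper end for [j = 1] and at the
   lower end for [j = 2]. The rays 1 and 2 lead back to [q] and [p]. That this
   set is the line is [stable_line_bend]: the triples [(1, b, 2)] force a point
   of the line onto the path or one of the rays 1 and 2, except at coordinates
   where [h] has one given value, and the triples [(2, b, i)] allow only one such coordinate to deviate.

   So the vertices are the points [max(h, r)] for the distinct values [r] of
   [h] on the coordinates other than 1 and 2. They form a spine, which makes the
   tree a caterpillar, lie on the segment, and only depend combinatorially on
   the order of the values of [h], hence on [F]. A point of the line determines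
   its parameters, because [r] is the second smallest value of [y] when the
   second smallest value of [y - h] is normalized to 0 ([bend_inj]); hence
   distinct cells are disjoint ([line_tree_structure]). Between consecutive
   vertices exactly the coordinates of the leaves already passed increase, all
   at the same speed, so the edge directions are 0/1-vectors, which telescope at
   each vertex ([line_tree_balanced]).

   The tropical distance along the path is the difference of the parameters
   ([tdist_path]). All distances in question are therefore differences of values
   of [h] at two coordinates, and the vertices closest to [p] and [q] are the two
   ends of the spine. If the values of [h] on the coordinates other than 1 and 2
   are pairwise distinct, which fails only on finitely many hyperplanes, then
   each vertex carries one such leaf and two further neighbours. *)

(** * Trees whose inner vertices form a path *)

(** A node of maximal rank in a cycle has its two neighbours there among those
   of rank at most its own. Hence they coincide, and the cycle is degenerate. *)
Lemma ucycle_short_of_rank (V : finType) (e : rel V) (rk : V -> nat) :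
  symmetric e ->
  (forall x y z, e x y -> e x z ->
     (rk y <= rk x)%N -> (rk z <= rk x)%N -> y = z) ->
  forall s : seq V, ucycle e s -> (size s <= 2)%N.
Proof.
move=> esym uniq_below [|x0 s] // /andP[cyc uniq_s].
have [x xs xmax] : exists2 x, x \in x0 :: s &
    forall y, y \in x0 :: s -> (rk y <= rk x)%N.
  case: (@arg_maxnP _ x0 (mem (x0 :: s)) rk) => [|x xs xmax].
    exact: mem_head.
  by exists x.
have [k s' rots] := rot_to xs.
have memr y : (y \in x :: s') = (y \in x0 :: s) by rewrite -rots mem_rot.
have: ucycle e (x :: s') by rewrite -rots /ucycle rot_cycle rot_uniq cyc.
rewrite -(size_rot k) rots.
case: s' {rots} memr => [|y s'] // memr.
case/lastP: s' memr => [|s' z] // memr.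
rewrite /ucycle [cycle _ _]rcons_path /= last_rcons.
case/andP=> /andP[/andP[exy _] ezx] /andP[_ /andP[uniq_ys _]].
have yz : y = z.
  apply: (uniq_below x) => //; first by rewrite esym.
    by apply: xmax; rewrite -memr !inE eqxx orbT.
  by apply: xmax; rewrite -memr !inE mem_rcons inE eqxx !orbT.
by move: uniq_ys; rewrite yz mem_rcons inE eqxx.
Qed.

(** A caterpillar is encoded by the length of its spine and its leaf map. Its
   splits are computed from [f] alone, whatever the positions [pos] are. *)
Definition path_tree (R : realType) (n m : nat)
    (pos : 'I_m.+1 -> tpoint R n) (f : 'I_n -> 'I_m.+1) : embedded_tree R n :=
  EmbeddedTree pos (fun u v => (u.+1 == v :> nat) || (v.+1 == u :> nat)) f.

Section PathTree.
Variables (R : realType) (n m : nat).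
Variables (pos : 'I_m.+1 -> tpoint R n) (f : 'I_n -> 'I_m.+1).
Let T := path_tree pos f.
Implicit Types (u v : 'I_m.+1) (j : 'I_n).

Lemma path_tree_rel_sym : symmetric (@tree_rel R n T).
Proof. by case=> [u|i] [v|j] //=; rewrite orbC. Qed.

Lemma path_tree_connected (x y : tnode T) : connect (@tree_rel R n T) x y.
Proof.
have csym := sym_connect_sym path_tree_rel_sym.
suff from0 z : connect (@tree_rel R n T) (inl ord0) z.
  by apply: connect_trans (from0 y); rewrite csym.
have from0_spine k (lt_km : (k < m.+1)%N) :
    connect (@tree_rel R n T) (inl ord0) (inl (Ordinal lt_km)).
  elim: k lt_km => [|k IH] lt_km.
    by rewrite (_ : Ordinal lt_km = ord0) //; apply: val_inj.
  apply: connect_trans (IH (ltnW lt_km)) (connect1 _).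
  by rewrite /= eqxx.
case: z => [[k lt_km]|j]; first exact: from0_spine.
apply: (@connect_trans _ _ (inl (f j))); last by apply: connect1; rewrite /= eqxx.
by case: (f j).
Qed.

(** For the rank that grows along the spine and is largest at the leaves, the
   only neighbour of the spine vertex [u] that does not exceed it is [u - 1],
   while a leaf has only one neighbour altogether. *)
Lemma path_tree_is_tree : is_tree T.
Proof.
split; [exact: path_tree_rel_sym | | exact: path_tree_connected | ].
  by case=> [u|i] //=; lia.
pose rk (x : tnode T) : nat := if x is inl u then u : 'I_m.+1 else m.+1.
apply: (ucycle_short_of_rank (rk := rk)); first exact: path_tree_rel_sym.
case=> [u|i] [v|j] [w|k] //=.
- by move=> h1 h2 h3 h4; congr inl; apply: val_inj => /=; lia.
- by have := ltn_ord u; lia.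
- by have := ltn_ord u; lia.
- by have := ltn_ord u; lia.
- by move=> /eqP <- /eqP <-.
Qed.

Lemma path_tree_leaf_degree j : degree (T := T) (inr j) = 1%N.
Proof.
rewrite /degree (eq_card (B := pred1 (inl (f j) : tnode T))) ?card1 //.
by case=> [u|i] //=; rewrite inE /= eq_sym.
Qed.

Lemma path_tree_caterpillar : caterpillar T.
Proof.
have Ee : enum 'I_m.+1 = ord0 :: behead (enum 'I_m.+1).
  by case E : (enum _) (enum_ordSl m) => [|a l] // [-> _].
exists (inl ord0), [seq (inl u : tnode T) | u <- behead (enum 'I_m.+1)].
have -> : (inl ord0 : tnode T) :: [seq (inl u : tnode T) | u <- behead (enum 'I_m.+1)]
   = [seq (inl u : tnode T) | u <- enum 'I_m.+1] by rewrite [in RHS]Ee.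
split.
- set e := @tree_rel R n T.
  have spath : sorted (fun u v : 'I_m.+1 => e (inl u) (inl v)) (enum 'I_m.+1).
    have := iota_sorted.
    have: sorted (fun a b => a.+1 == b) (iota 0 m.+1).
      by rewrite /=; elim: m 0%N => //= k IH a; rewrite eqxx IH.
    rewrite -val_enum_ord sorted_map => s1 _.
    by apply: sub_sorted s1 => u v /= ->.
  by move: spath; rewrite Ee /= path_map.
- by rewrite map_inj_uniq ?enum_uniq // => a b [].
- case=> [u|j] => [_|].
    by apply/mapP; exists u => //; rewrite mem_enum.
  by rewrite path_tree_leaf_degree.
Qed.

(** At an end of the spine a leaf replaces the missing neighbour. In this way
   the ends need no separate count: every spine vertex has two such neighbours,
   and its further neighbours are the other leaves attached to it. *)
Definition left_nbr (j0 : 'I_n) u : tnode T :=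
  if u == ord0 then inr j0 else inl (inord u.-1).
Definition right_nbr (j1 : 'I_n) u : tnode T :=
  if u == ord_max then inr j1 else inl (inord u.+1).

Section Degree.
Variables (j0 j1 : 'I_n).
Hypotheses (f0 : f j0 = ord0) (f1 : f j1 = ord_max) (neq01 : j0 != j1).

Lemma card_three_nbrs u j : j != j0 -> j != j1 ->
  #|[set left_nbr j0 u; right_nbr j1 u; inr j : tnode T]%SET| = 3%N.
Proof.
move=> /negPf jj0 /negPf jj1.
have lr : left_nbr j0 u != right_nbr j1 u.
  rewrite /left_nbr /right_nbr; case: (eqVneq u ord0) => [u0|u0];
    case: (eqVneq u ord_max) => [um|um].
  - by apply: contra neq01 => /eqP[->].
  - by [].
  - by [].
  - apply/eqP=> -[/(congr1 val)] /=.
    move: u0 um; rewrite -!val_eqE /= => u0 um.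
    have := ltn_ord u => ltu.
    by rewrite !inordK; lia.
have lj : (inr j == left_nbr j0 u) = false.
  by rewrite /left_nbr; case: ifP => _ //; apply/eqP => -[ej]; rewrite ej eqxx in jj0.
have rj : (inr j == right_nbr j1 u) = false.
  by rewrite /right_nbr; case: ifP => _ //; apply/eqP => -[ej]; rewrite ej eqxx in jj1.
by rewrite finset.setUC cardsU1 !inE lj rj /= cards2 lr.
Qed.

Lemma tree_rel_left u : tree_rel (inl u : tnode T) (left_nbr j0 u).
Proof.
rewrite /left_nbr; case: eqP => [->|/eqP u0] /=; first by rewrite f0.
move: u0; rewrite -val_eqE /= => u0; have := ltn_ord u => ltu.
by rewrite inordK; lia.
Qed.

Lemma tree_rel_right u : tree_rel (inl u : tnode T) (right_nbr j1 u).
Proof.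
rewrite /right_nbr; case: eqP => [->|/eqP u0] /=; first by rewrite f1.
move: u0; rewrite -val_eqE /= => u0; have := ltn_ord u => ltu.
by rewrite inordK; lia.
Qed.

Lemma path_tree_degree_ge3 u j : f j = u -> j != j0 -> j != j1 ->
  (3 <= degree (T := T) (inl u))%N.
Proof.
move=> fj jj0 jj1; rewrite -(card_three_nbrs u jj0 jj1); apply: subset_leq_card.
apply/fintype.subsetP => x; rewrite !inE => /orP[/orP[]|] /eqP->.
- exact: tree_rel_left.
- exact: tree_rel_right.
- by rewrite /= fj.
Qed.

Lemma path_tree_trivalent :
  (forall u, exists2 j, f j = u & (j != j0) && (j != j1)) ->
  (forall j k, j != j0 -> j != j1 -> k != j0 -> k != j1 -> f j = f k -> j = k) ->
  trivalent T.
Proof.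
move=> fsurj finj u.
have [j fj /andP[jj0 jj1]] := fsurj u.
rewrite -(card_three_nbrs u jj0 jj1); apply: eq_card => x; rewrite !inE.
apply/idP/idP => [|/orP[/orP[]|] /eqP->]; last 3 first.
- exact: tree_rel_left.
- exact: tree_rel_right.
- by rewrite /= fj.
have := ltn_ord u => ltu; case: x => [v|k] /=.
  have := ltn_ord v => ltv /orP[] /eqP uv.
    rewrite /right_nbr ifF; last by apply/eqP=> um; move: uv; rewrite um /=; lia.
    apply/orP; left; apply/orP; right; apply/eqP; congr inl.
    by apply: val_inj; rewrite /= inordK uv.
  rewrite /left_nbr ifF; last by apply/eqP=> um; move: uv; rewrite um /=; lia.
  apply/orP; left; apply/orP; left; apply/eqP; congr inl.
  by apply: val_inj; rewrite /= inordK -uv /=; lia.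
move=> /eqP fk.
have [ek0|kj0] := eqVneq k j0.
  by rewrite -fk ek0 f0 /left_nbr eqxx eqxx.
have [ek1|kj1] := eqVneq k j1.
  by rewrite -fk ek1 f1 /right_nbr eqxx eqxx orbT.
by rewrite (finj k j) ?eqxx ?orbT // fk fj.
Qed.

End Degree.
End PathTree.

(** * Coordinates modulo the all-ones vector *)

(** The class of [y] in [V^(n+1) / V(1, ..., 1)], normalized by a zero last
   coordinate. It is used with [V = R] for points and with [V = int] for
   primitive directions. *)
Definition class_of (V : zmodType) (n : nat) (y : 'I_n.+1 -> V) : 'cV[V]_n :=
  \col_(j < n) (y (lift ord_max j) - y ord_max).

Lemma class_of0 (V : zmodType) n (y : 'I_n.+1 -> V) (c : V) :
  (forall i, y i = c) -> class_of y = 0.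
Proof. by move=> yc; apply/colP => j; rewrite !mxE !yc subrr. Qed.

Section Coordinates.
Variables (R : realType) (n : nat).
Implicit Types (x p q : tpoint R n.+1) (y z : 'I_n.+1 -> R) (i j : 'I_n.+1).

Lemma rep_lift x (j : 'I_n) : rep x (lift ord_max j) 0 = x j 0.
Proof.
rewrite mxE; case: insubP => [k _ vk|]; last by rewrite lift_max ltn_ord.
by congr (x _ 0); apply: val_inj; rewrite [LHS]vk lift_max.
Qed.

Lemma rep_max x : rep x ord_max 0 = 0.
Proof. by rewrite mxE; case: insubP => //= k; rewrite ltnn. Qed.

Lemma eq_rep x x' : (forall i, rep x i 0 = rep x' i 0) -> x = x'.
Proof. by move=> e; apply/colP => j; rewrite -!rep_lift e. Qed.

Lemma rep_class_of y i : rep (class_of y : tpoint R n.+1) i 0 = y i - y ord_max.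
Proof.
case: (unliftP ord_max i) => [j|] ->; first by rewrite rep_lift mxE.
by rewrite rep_max subrr.
Qed.

Lemma rep_add x x' i : rep (x + x') i 0 = rep x i 0 + rep x' i 0.
Proof.
by case: (unliftP ord_max i) => [j|] ->; rewrite ?rep_lift ?rep_max ?addr0 ?mxE.
Qed.

Lemma rep_scale (a : R) x i : rep (a *: x) i 0 = a * rep x i 0.
Proof.
by case: (unliftP ord_max i) => [j|] ->; rewrite ?rep_lift ?rep_max ?mulr0 ?mxE.
Qed.

Lemma ray_dirE j :
  ray_dir R j = class_of (fun i => - (i == j)%:R) :> tpoint R n.+1.
Proof.
apply/colP => i; rewrite !mxE -!val_eqE [val (lift _ _)]lift_max [val ord_max]/= eqSS opprK.
rewrite [n == _]eq_sym; case: eqP => [jn|_]; last by rewrite addr0.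
have -> : (val i == val j :> nat) = false.
  by apply/eqP => ein; have : (val i < n)%N := ltn_ord i; rewrite ein [val j]jn ltnn.
by rewrite oppr0 add0r.
Qed.

(** Relative to [q] the tropical segment and the line take a form that only
   involves the coordinate differences of [p] and [q]. *)
Definition offset q y : tpoint R n.+1 := class_of (fun i => rep q i 0 + y i).

Lemma rep_offset q y i : rep (offset q y) i 0 = rep q i 0 + y i - y ord_max.
Proof. by rewrite rep_class_of rep_max add0r. Qed.

Lemma eq_offset q y z :
  offset q y = offset q z <-> exists c, forall i, y i = z i + c.
Proof.
split=> [e|[c e]].
  exists (y ord_max - z ord_max) => i.
  by have := rep_offset q y i; rewrite e rep_offset; lra.
by apply: eq_rep => i; rewrite !rep_offset !e; lra.
Qed.

Lemma offset_eqP q y x (c : R) :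
  (forall i, rep x i 0 = rep q i 0 + y i + c) -> x = offset q y.
Proof.
move=> e; apply: eq_rep => i; rewrite rep_offset e.
by have := e ord_max; rewrite !rep_max; lra.
Qed.

Lemma offsetE q x : x = offset q (fun i => rep x i 0 - rep q i 0).
Proof. by apply: (@offset_eqP _ _ _ 0) => i; lra. Qed.

Lemma offset_convex q y z (t : R) :
  (1 - t) *: offset q y + t *: offset q z =
  offset q (fun i => (1 - t) * y i + t * z i).
Proof.
by apply: eq_rep => i; rewrite rep_add !rep_scale !rep_offset; lra.
Qed.

Lemma offset_ray q y (t : R) j :
  offset q y + t *: ray_dir R j = offset q (fun i => y i - t * (i == j)%:R).
Proof.
by apply: eq_rep => i; rewrite rep_add rep_scale ray_dirE !rep_offset rep_class_of; ring.
Qed.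

Lemma offset_sub q y z :
  offset q z - offset q y = class_of (fun i => z i - y i).
Proof.
apply: eq_rep => i.
by rewrite rep_add -scaleN1r rep_scale !rep_offset rep_class_of; lra.
Qed.

(** The tropical distance is the oscillation of the coordinatewise difference;
   the terms [|p_i - q_i|] of its definition are oscillations against the last
   coordinate. *)
Lemma tdist_osc p q (y : 'I_n.+1 -> R) (c d : R) i0 i1 :
  (forall i, rep p i 0 - rep q i 0 = y i + c) ->
  (forall i, 0 <= y i <= d) -> y i0 = 0 -> y i1 = d ->
  tdist p q = d.
Proof.
move=> diff yd y0 y1; apply/eqP; rewrite eq_le; apply/andP; split.
  have d0 : 0 <= d by have := yd i0; rewrite y0; case/andP.
  apply: bigmax_le => // i _; apply: bigmax_le => // j _.
  have := diff ord_max; rewrite !rep_max => dmax.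
  rewrite ge_max !ler_norml.
  have := diff i; have := diff j => dj di.
  have := yd i; have := yd j; have := yd ord_max.
  by move=> /andP[? ?] /andP[? ?] /andP[? ?]; apply/andP; split; apply/andP; split; lra.
rewrite /tdist; apply: (@bigmax_sup _ _ _ _ i1) => //.
apply: (@bigmax_sup _ _ _ _ i0) => //.
rewrite le_max; apply/orP; right; apply: le_trans (ler_norm _).
by have := diff i0; have := diff i1; lra.
Qed.

Lemma tdist_sym p q : tdist p q = tdist q p.
Proof.
rewrite /tdist; apply: eq_bigr => i _; apply: eq_bigr => j _.
by congr (Num.max _ _); rewrite -normrN; congr `|_|; lra.
Qed.

Lemma open_segment_sym x x' : open_segment x x' = open_segment x' x.
Proof.
suff sub (a b : tpoint R n.+1) : (open_segment a b `<=` open_segment b a)%classic.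
  by apply/seteqP; split.
move=> _ [t /= /andP[t0 t1] <-]; exists (1 - t) => /=.
  by apply/andP; split; lra.
by rewrite addrC; congr (_ + _ *: _); lra.
Qed.

(** A 0/1-vector that is not constant has a primitive class: modulo [1] and in
   the [n] first coordinates, some entry is a unit. *)
Lemma primitive_class (chi : pred 'I_n.+1) (a b : 'I_n.+1) (s : int) :
  chi a -> ~~ chi b -> `|s|%N = 1%N ->
  \big[gcdn/0%N]_(i < n)
     `|(s *: class_of (fun i => (chi i)%:R : int))%R i 0%R|%N = 1%N.
Proof.
move=> ca cb s1.
have [i ci] : exists i : 'I_n, chi (lift ord_max i) != chi ord_max.
  have [cm|cm] := boolP (chi ord_max).
    case: (unliftP ord_max b) cb => [i|] ->; last by rewrite cm.
    by exists i; rewrite (negPf cb).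
  case: (unliftP ord_max a) ca => [i|] ->; last by rewrite (negPf cm).
  by exists i; rewrite ca.
rewrite (bigD1 i) //= !mxE abszM s1 mul1n.
move: ci; case: (chi (lift ord_max i)); case: (chi ord_max) => // _;
  by rewrite gcd1n.
Qed.

End Coordinates.

(** * The stable line as a bent path with rays *)

Lemma max_attained_twiceP (R : realType) (a b c : R) :
  max_attained_twice a b c <->
  [/\ a <= Num.max b c, b <= Num.max a c & c <= Num.max a b].
Proof.
rewrite /max_attained_twice /= addn0 !eq_le.
case: (leP b c) => bc; case: (leP a b) => ab; case: (leP a c) => ac;
  rewrite ?bc ?ab ?ac ?lexx /=;
  repeat match goal with |- context [?x <= ?y] => case: (leP x y) => ? end;
  first [by split=> // -[] | by exfalso; lra].
Qed.

(** With multiplicities: at most one index has a value below [a], and at least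
   two have a value that is at most [a]. *)
Definition second_smallest (R : realType) (I : finType) (y : I -> R) (a : R) :=
  (exists j, forall i, i != j -> a <= y i) /\
  (exists i k, [/\ i != k, y i <= a & y k <= a]).

Lemma second_smallest_le (R : realType) (I : finType) (y : I -> R) a b :
  second_smallest y a -> second_smallest y b -> a <= b.
Proof.
move=> [[j ya] _] [_ [i [k [ik yi yk]]]].
have [ij|ij] := eqVneq i j.
  by apply: le_trans yk; apply: ya; rewrite eq_sym -ij.
by apply: le_trans yi; apply: ya.
Qed.

Lemma second_smallest_unique (R : realType) (I : finType) (y : I -> R) a b :
  second_smallest y a -> second_smallest y b -> a = b.
Proof. by move=> ya yb; apply/eqP; rewrite eq_le !(@second_smallest_le R I y). Qed.

Lemma second_smallest_shift (R : realType) (I : finType) (y z : I -> R) a c :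
  (forall i, z i = y i + c) -> second_smallest y a -> second_smallest z (a + c).
Proof.
move=> zy [[j ya] [i [k [ik yi yk]]]]; split.
  by exists j => l lj; rewrite zy lerD2r ya.
by exists i, k; rewrite !zy !lerD2r.
Qed.

(** Modulo [(1, ..., 1)] the path [s |-> max(h, s)] runs through the tropical
   segment from the class of [h] to the class of [0]. From this path the point
   moves by [t] in the direction of the ray [j]. *)
Definition bend (R : realType) (I : finType) (h : I -> R) (s t : R) (j i : I) : R :=
  Num.max (h i) s - t * (i == j)%:R.

(** The parameters [s 0 < ... < s m] of the vertices are the values of [h] at the
   leaves other than [cmin] and [cmax], which are attached at these values. The
   leaves [cmin] and [cmax], where [h] is extremal, are attached at the two
   ends, although [h] may lie beyond [s 0] and [s m] there. *)
Section BentPath.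
Variables (R : realType) (n m : nat) (h : 'I_n.+1 -> R) (s : nat -> R).
Variables (f : 'I_n.+1 -> 'I_m.+1) (cmax cmin : 'I_n.+1).
Hypothesis cmin_cmax : cmin != cmax.
Hypothesis f_cmax : f cmax = ord_max.
Hypothesis f_cmin : f cmin = ord0.
Hypothesis f_surj : forall u, exists2 j, f j = u & (j != cmin) && (j != cmax).
Hypothesis h_f : forall j, j != cmin -> j != cmax -> h j = s (f j).
Hypothesis h_ge : forall i, h cmin <= h i.
Hypothesis h_le : forall i, h i <= h cmax.
Hypothesis s_lt : forall a b, (a <= m)%N -> (b <= m)%N -> (s a < s b) = (a < b)%N.
Implicit Types (i j k : 'I_n.+1) (u v : 'I_m.+1) (t : R).

Lemma s_le a b : (a <= m)%N -> (b <= m)%N -> (s a <= s b) = (a <= b)%N.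
Proof. by move=> am bm; rewrite leNgt s_lt // -leqNgt. Qed.

Lemma h_surj u : exists2 j, h j = s u & [/\ j != cmin, j != cmax & f j = u].
Proof. by have [j fj /andP[j0 j1]] := f_surj u; exists j; rewrite ?h_f ?fj. Qed.

Lemma h_cmin_le : h cmin <= s 0.
Proof. by have [j <- _] := h_surj ord0. Qed.

Lemma h_cmax_ge : s m <= h cmax.
Proof. by have [j <- _] := h_surj ord_max. Qed.

Lemma h_le_s i u : (u < m)%N -> (f i <= u)%N -> h i <= s u.
Proof.
move=> um fiu.
have [->|i0] := eqVneq i cmin; first by apply: le_trans h_cmin_le _; rewrite s_le // ltnW.
have [ei|i1] := eqVneq i cmax; first by move: fiu; rewrite ei f_cmax /=; lia.
by rewrite h_f // s_le //; have := ltn_ord u; lia.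
Qed.

Lemma h_ge_s i (a : nat) : (0 < a)%N -> (a <= f i)%N -> s a <= h i.
Proof.
move=> a0 afi; have am : (a <= m)%N by have := ltn_ord (f i); lia.
have [ei|i0] := eqVneq i cmin; first by move: afi; rewrite ei f_cmin /=; lia.
have [->|i1] := eqVneq i cmax; first by apply: le_trans h_cmax_ge; rewrite s_le.
by rewrite h_f // s_le //; have := ltn_ord (f i); lia.
Qed.

(** Between consecutive breakpoints [s a] and [s a.+1] exactly the coordinates
   with [f i <= a] grow. *)
Lemma max_between i (a : nat) (r : R) : (a < m)%N -> s a <= r <= s a.+1 ->
  Num.max (h i) r = Num.max (h i) (s a) + (r - s a) * (f i <= a)%:R.
Proof.
move=> am /andP[ar ra]; have au : (a < m.+1)%N by lia.
have [fia|afi] := leqP (f i) a.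
  have hi : h i <= s a := @h_le_s i (Ordinal au) am fia.
  by rewrite (max_r hi) max_r ?(le_trans hi ar) //= mulr1 addrC subrK.
have hi := @h_ge_s i a.+1 (ltn0Sn a) afi.
by rewrite (max_l (le_trans ra hi)) max_l ?(le_trans ar (le_trans ra hi)) //= mulr0 addr0.
Qed.

(** On the path the minimum [r] of [max(h, r)] is attained at [cmin] and at
   another leaf of the first vertex. Lowering one coordinate turns it into the
   second smallest value. *)
Lemma second_smallest_bend r t j : 0 <= t -> s 0 <= r ->
  second_smallest (bend h r t j) r.
Proof.
move=> t0 sr; split.
  by exists j => i /negPf ij; rewrite /bend ij mulr0 subr0 le_max lexx orbT.
have [k hk [kc _ _]] := h_surj ord0.
have low i : h i <= r -> bend h r t j i <= r.
  by move=> hr; rewrite /bend max_r //; case: (i == j) => /=; lra.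
exists k, cmin; rewrite kc; split=> //; apply: low; first by rewrite hk.
exact: le_trans h_cmin_le sr.
Qed.

(** Dually, the minimum [0] of [max(h, r) - h] is attained at [cmax] and at
   another leaf of the last vertex. *)
Lemma second_smallest_bend_sub r t j : 0 <= t -> r <= s m ->
  second_smallest (fun i => bend h r t j i - h i) 0.
Proof.
move=> t0 sr; split.
  by exists j => i /negPf ij; rewrite /bend ij mulr0 subr0 subr_ge0 le_max lexx.
have [k hk [_ kc _]] := h_surj ord_max.
have low i : r <= h i -> bend h r t j i - h i <= 0.
  by move=> hr; rewrite /bend max_l //; case: (i == j) => /=; lra.
exists k, cmax; rewrite kc; split=> //; apply: low; first by rewrite hk.
exact: le_trans sr h_cmax_ge.
Qed.

(** Parameters of the points of the line: rays start at the breakpoint of their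
   leaf. *)
Definition admissible r t j :=
  [/\ s 0 <= r <= s m, 0 <= t & 0 < t -> r = s (f j)].

(** The second smallest values of [y] and of [y - h] recover [r] and the additive
   constant; a multiple of a unit vector remains. *)
Lemma bend_inj r t j r' t' j' c :
  admissible r t j -> admissible r' t' j' ->
  (forall i, bend h r t j i = bend h r' t' j' i + c) ->
  [/\ r = r', t = t' & 0 < t -> j = j'].
Proof.
move=> [/andP[r0 rm] t0 _] [/andP[r'0 r'm] t'0 _] e.
have e1 : r = r' + c.
  apply: second_smallest_unique (second_smallest_bend j t0 r0) _.
  exact: second_smallest_shift e (second_smallest_bend j' t'0 r'0).
have c0 : 0 = 0 + c.
  apply: second_smallest_unique (second_smallest_bend_sub j t0 rm) _.
  by apply: second_smallest_shift (second_smallest_bend_sub j' t'0 r'm) => i; rewrite e; lra.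
have {}e1 : r = r' by lra.
rewrite {}e1 in e *.
have {}e i : t * (i == j)%:R = t' * (i == j')%:R :> R.
  by have := e i; rewrite /bend; lra.
have := e j; have := e j'; rewrite !eqxx.
case: (eqVneq j j') => [->|_] /= e1 e2; split=> //.
- by lra.
- by lra.
- by move=> t_gt0; exfalso; lra.
Qed.

Lemma h_le_top i : i != cmax -> h i <= s m.
Proof.
move=> i1; have [->|i0] := eqVneq i cmin.
  by apply: le_trans h_cmin_le _; rewrite s_le.
by rewrite h_f // s_le //; have := ltn_ord (f i); lia.
Qed.

Lemma h_ge_bot i : i != cmin -> s 0 <= h i.
Proof.
move=> i0; have [->|i1] := eqVneq i cmax.
  by apply: le_trans h_cmax_ge; rewrite s_le.
by rewrite h_f // s_le //; have := ltn_ord (f i); lia.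
Qed.

(** One third of the condition that a maximum is attained twice, for the points
   [h] and [0]; the other two thirds are obtained by permuting [a, b, c]. *)
Definition line_ineq (y : 'I_n.+1 -> R) (a b c : 'I_n.+1) : Prop :=
  y a + Num.max (h b) (h c) <=
  Num.max (y b + Num.max (h a) (h c)) (y c + Num.max (h a) (h b)).

Lemma line_ineq_sym y a b c : line_ineq y a b c -> line_ineq y a c b.
Proof. by rewrite /line_ineq (maxC (h b)) (maxC (y b + _)). Qed.

Lemma stable_lineP (p q : tpoint R n.+1) (c0 : R) :
  (forall i, rep p i 0 = rep q i 0 + h i + c0) ->
  forall y, stable_line p q (offset q y) <->
    (forall a b c, a != b -> a != c -> b != c -> line_ineq y a b c).
Proof.
move=> ph y.
have term a b c (K : R) : K = rep q a 0 + rep q b 0 + rep q c 0 + c0 - y ord_max ->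
    rep (offset q y) a 0 + Num.max (rep p b 0 + rep q c 0) (rep p c 0 + rep q b 0)
    = y a + Num.max (h b) (h c) + K.
  move=> ->; rewrite rep_offset.
  have -> : Num.max (rep p b 0 + rep q c 0) (rep p c 0 + rep q b 0) =
      Num.max (h b) (h c) + (rep q b 0 + rep q c 0 + c0).
    by rewrite addr_maxl !ph; congr (Num.max _ _); lra.
  by lra.
have tripleP a b c :
    max_attained_twice
      (rep (offset q y) a 0 + Num.max (rep p b 0 + rep q c 0) (rep p c 0 + rep q b 0))
      (rep (offset q y) b 0 + Num.max (rep p a 0 + rep q c 0) (rep p c 0 + rep q a 0))
      (rep (offset q y) c 0 + Num.max (rep p a 0 + rep q b 0) (rep p b 0 + rep q a 0))
    <-> [/\ line_ineq y a b c, line_ineq y b a c & line_ineq y c a b].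
  pose K := rep q a 0 + rep q b 0 + rep q c 0 + c0 - y ord_max.
  rewrite max_attained_twiceP (term a b c K) // (term b a c K); last by rewrite /K; lra.
  rewrite (term c a b K); last by rewrite /K; lra.
  rewrite -!addr_maxl !lerD2r /line_ineq.
  by rewrite (maxC (h b) (h a)) (maxC (h c) (h b)) (maxC (h c) (h a)).
split=> [L a b c ab ac bc|E a b c ab bc]; last first.
  have ab' : a != b by rewrite -val_eqE neq_ltn ab.
  have bc' : b != c by rewrite -val_eqE neq_ltn bc.
  have ac' : a != c by rewrite -val_eqE neq_ltn (ltn_trans ab bc).
  by apply/tripleP; split; apply: E => //; rewrite eq_sym.
have {}L (a' b' c' : 'I_n.+1) : (a' < b')%N -> (b' < c')%N ->
    [/\ line_ineq y a' b' c', line_ineq y b' a' c' & line_ineq y c' a' b'].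
  by move=> ab' bc'; apply/tripleP; apply: L.
move: ab ac bc; rewrite -!val_eqE /= => ab ac bc.
case: (ltngtP a b) ab => // ab _; case: (ltngtP b c) bc => // bc _;
  case: (ltngtP a c) ac => // ac _.
- by have [] := L a b c ab bc.
- by have := ltn_trans ab bc; rewrite ltnNge (ltnW ac).
- by have [? _ _] := L a c b ac bc; apply: line_ineq_sym.
- by have [_ ? _] := L c a b ac ab; apply: line_ineq_sym.
- by have [_ ? _] := L b a c ab ac.
- by have [_ _ ?] := L b c a bc ac.
- by have := ltn_trans bc ab; rewrite ltnNge (ltnW ac).
- by have [_ _ ?] := L c b a bc ab; apply: line_ineq_sym.
Qed.

Lemma line_ineq_path r a b c :
  line_ineq (fun i => Num.max (h i) r) a b c.
Proof.
rewrite /line_ineq.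
case: (leP (h b) (h c)) => bc; case: (leP (h a) r) => ar;
case: (leP (h b) r) => br; case: (leP (h c) r) => cr;
case: (leP (h a) (h c)) => ac; case: (leP (h a) (h b)) => ab;
by rewrite le_max; apply/orP; first [left; lra | right; lra].
Qed.

(** The two sides are in fact equal: at the start of the ray [b] the maximum is
   attained by the two terms other than that of [b], so lowering [y b] does no
   harm. *)
Lemma line_ineq_ray a b c (r := s (f b)) :
  a != b -> c != b ->
  Num.max (h a) r + Num.max (h b) (h c) <= Num.max (h c) r + Num.max (h a) (h b).
Proof.
rewrite /r; have [->|b0] := eqVneq b cmin.
  move=> a0 c0; rewrite f_cmin /=.
  by rewrite (max_l (h_ge_bot a0)) (max_l (h_ge_bot c0)) (max_r (h_ge c)) (max_l (h_ge a)) addrC.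
have [->|b1] := eqVneq b cmax.
  move=> a1 c1; rewrite f_cmax /=.
  by rewrite (max_r (h_le_top a1)) (max_r (h_le_top c1)) (max_l (h_le c)) (max_r (h_le a)).
by rewrite (h_f b0 b1) (maxC (s (f b)) (h c)) addrC.
Qed.

Lemma line_ineq_bend r t j a b c : admissible r t j ->
  a != b -> a != c -> b != c -> line_ineq (bend h r t j) a b c.
Proof.
move=> [_ t0 rj] ab ac bc.
have le_bend : bend h r t j a <= Num.max (h a) r.
  by rewrite /bend; case: (a == j) => /=; lra.
have base b' c' : b' != j -> c' != j -> line_ineq (bend h r t j) a b' c'.
  move=> /negPf b'j /negPf c'j; have := line_ineq_path r a b' c'.
  rewrite /line_ineq {2 3}/bend b'j c'j !mulr0 !subr0; apply: le_trans.
  by rewrite lerD2r.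
have on_ray b' c' : b' = j -> a != b' -> b' != c' -> line_ineq (bend h r t j) a b' c'.
  move=> b'j ab' b'c'; have [t_gt0|t_le0] := ltP 0 t; last first.
    have t0' : t = 0 by lra.
    have := line_ineq_path r a b' c'.
    by rewrite /line_ineq /bend t0' !mul0r !subr0.
  rewrite /line_ineq le_max; apply/orP; right.
  have /negPf c'j : c' != j by rewrite -b'j eq_sym.
  rewrite {2}/bend c'j mulr0 subr0 (rj t_gt0) -b'j.
  apply: le_trans (line_ineq_ray ab' _); last by rewrite eq_sym.
  by rewrite lerD2r b'j -(rj t_gt0).
have [bj|bj] := eqVneq b j; first exact: on_ray.
have [cj|cj] := eqVneq c j; last exact: base.
by apply: line_ineq_sym; apply: on_ray => //; rewrite eq_sym.
Qed.

(** The triples [(cmax, b, cmin)] force all coordinates up to the ties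
   [h b = y cmin - y cmax + h cmax]; the triples [(cmin, b, i)] leave room for
   one deviating coordinate among the ties. *)
Lemma line_ineq_admissible y :
  (forall a b c, a != b -> a != c -> b != c -> line_ineq y a b c) ->
  exists r t j, admissible r t j /\
    exists c, forall i, y i = bend h r t j i + c.
Proof.
move=> E.
pose al := y cmax - h cmax; pose r := y cmin - al.
have ymax : y cmax = h cmax + al by rewrite /al; lra.
have ymin : y cmin = r + al by rewrite /r; lra.
have Ey b : b != cmin -> b != cmax ->
    (h b != r -> y b = Num.max (h b) r + al) /\ (h b = r -> y b <= r + al).
  move=> b0 b1.
  have := E cmax b cmin; have := E b cmax cmin; have := E cmin cmax b.
  rewrite /line_ineq (eq_sym cmin b) (eq_sym cmax b) (eq_sym cmax cmin) b0 b1 cmin_cmax.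
  move=> /(_ isT isT isT) E1 /(_ isT isT isT) E2 /(_ isT isT isT) E3.
  move: E1 E2 E3.
  rewrite (max_l (h_le b)) (max_r (h_ge b)) (max_l (h_ge b)) (max_l (h_le cmin)).
  rewrite (max_r (h_le cmin)) (max_r (h_le b)) ymax ymin !le_max.
  move=> /orP E1 /orP E2 /orP E3; split=> hbr; last first.
    by case: E2 => ?; lra.
  by case: (ltgtP (h b) r) hbr => // hbr _; case: E1; case: E2; case: E3 => ? ? ?; lra.
have low b : b != cmin -> b != cmax -> h b < r -> y b = r + al.
  by move=> b0 b1 hb; rewrite (Ey b b0 b1).1 ?lt_eqF // max_r // ltW.
have high b : b != cmin -> b != cmax -> r < h b -> y b = h b + al.
  by move=> b0 b1 hb; rewrite (Ey b b0 b1).1 ?gt_eqF // max_l // ltW.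
have s0m : s 0 <= s m by rewrite s_le.
have [rm|rm] := ltP (s m) r.
  (* Beyond the upper end the point lies on the ray of [cmax]. *)
  exists (s m), (r - s m), cmax; split.
    by split; rewrite ?f_cmax ?s0m ?lexx //; lra.
  exists (r + al - s m) => i; rewrite /bend.
  have [->|i1] := eqVneq i cmax; first by rewrite max_l ?h_cmax_ge // ymax /=; lra.
  have him := h_le_top i1; rewrite max_r //=.
  have [->|i0] := eqVneq i cmin; first by lra.
  by rewrite low //; lra.
have [r0|r0] := ltP r (s 0).
  (* Below the lower end the point lies on the ray of [cmin]. *)
  exists (s 0), (s 0 - r), cmin; split.
    by split; rewrite ?f_cmin ?s0m ?lexx //; lra.
  exists al => i; rewrite /bend.
  have [->|i0] := eqVneq i cmin; first by rewrite max_r ?h_cmin_le // ymin /=; lra.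
  have him := h_ge_bot i0; rewrite max_l //=.
  have [->|i1] := eqVneq i cmax; first by lra.
  by rewrite high //; lra.
have hmax := h_cmax_ge; have hmin := h_cmin_le.
have off i : i != cmin -> i != cmax -> h i != r -> y i = Num.max (h i) r + al.
  by move=> i0 i1; apply: (Ey i i0 i1).1.
have [b /and4P[b0 b1 /eqP hb yb]|nob] :=
  pickP [pred b | [&& b != cmin, b != cmax, h b == r & y b < r + al]].
  exists r, (r + al - y b), b; split.
    split; [by rewrite r0 rm | by lra | by rewrite -hb h_f].
  exists al => i; rewrite /bend; have [->|ib] := eqVneq i b.
    by rewrite hb maxxx /=; lra.
  rewrite mulr0 subr0.
  have [->|i1] := eqVneq i cmax; first by rewrite max_l //; lra.
  have [->|i0] := eqVneq i cmin; first by rewrite max_r //; lra.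
  have [hi|hi] := eqVneq (h i) r; last exact: off.
  have yi := (Ey i i0 i1).2 hi.
  have := E cmin b i; rewrite eq_sym b0 eq_sym i0 eq_sym ib => /(_ isT isT isT).
  rewrite /line_ineq (max_r (h_ge _)) (max_r (h_ge b)) hi hb maxxx ymin le_max.
  by case/orP; lra.
exists r, 0, cmax; split; first by split; rewrite ?r0 ?rm //; lra.
exists al => i; rewrite /bend mul0r subr0.
have [->|i1] := eqVneq i cmax; first by rewrite max_l //; lra.
have [->|i0] := eqVneq i cmin; first by rewrite max_r //; lra.
have [hi|hi] := eqVneq (h i) r; last exact: off.
have yi := (Ey i i0 i1).2 hi; have := nob i.
by rewrite /= i0 i1 hi eqxx maxxx /=; case: ltP => //; lra.
Qed.

Variable q : tpoint R n.+1.

Definition line_pt r t j : tpoint R n.+1 := offset q (bend h r t j).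

Lemma stable_line_bend (p : tpoint R n.+1) (c0 : R) :
  (forall i, rep p i 0 = rep q i 0 + h i + c0) ->
  forall x, stable_line p q x <->
    exists r t j, admissible r t j /\ x = line_pt r t j.
Proof.
move=> ph x; split=> [|[r [t [j [adm ->]]]]].
  rewrite {1}(offsetE q x) (stable_lineP ph) => /line_ineq_admissible[r [t [j [adm e]]]].
  exists r, t, j; split=> //; rewrite (offsetE q x).
  by apply/eq_offset.
by apply/(stable_lineP ph) => a b c; apply: line_ineq_bend.
Qed.

Definition path_pt r : tpoint R n.+1 := offset q (fun i => Num.max (h i) r).

Lemma line_pt0 r j : line_pt r 0 j = path_pt r.
Proof.
by apply/eq_offset; exists 0 => i; rewrite /bend mul0r subr0 addr0.
Qed.

Definition line_tree : embedded_tree R n.+1 :=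
  path_tree (fun u : 'I_m.+1 => path_pt (s u)) f.

(** * The cells of the line *)

(** Vertices, edges [{a, a+1}] and rays: each edge occurs once here, whereas
   adjacency lists it with both orientations. *)
Definition stratum : Type := ('I_m.+1 + 'I_m + 'I_n.+1)%type.

Definition stratum_set (k : stratum) : set (tpoint R n.+1) :=
  match k with
  | inl (inl u) => [set path_pt (s u)]%classic
  | inl (inr a) => open_segment (path_pt (s a)) (path_pt (s a.+1))
  | inr j => open_ray (path_pt (s (f j))) (ray_dir R j)
  end.

(** The parameters of the points of a cell. A point of the path, where
   [t = 0], has parameters with every direction [j]. *)
Definition locus (k : stratum) r t j : Prop :=
  match k with
  | inl (inl u) => r = s u /\ t = 0
  | inl (inr a) => s a < r < s a.+1 /\ t = 0
  | inr j' => [/\ r = s (f j'), 0 < t & j = j']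
  end.

Lemma s_lt_succ (a : 'I_m) : s a < s a.+1.
Proof. by have am := ltn_ord a; rewrite s_lt // ltnW. Qed.

Lemma path_pt_convex (a : 'I_m) t : 0 <= t <= 1 ->
  (1 - t) *: path_pt (s a) + t *: path_pt (s a.+1) =
  path_pt (s a + t * (s a.+1 - s a)).
Proof.
case/andP=> t0 t1; have sa := s_lt_succ a.
rewrite offset_convex; apply/eq_offset; exists 0 => i; rewrite addr0.
rewrite (max_between i (a := a) (r := s a.+1)) ?(ltW sa) ?lexx //.
rewrite (max_between i (a := a) (r := s a + t * (s a.+1 - s a))) //; first by ring.
by apply/andP; split; nra.
Qed.

Lemma stratum_setP (k : stratum) x :
  stratum_set k x <-> exists r t j, locus k r t j /\ x = line_pt r t j.
Proof.
case: k => [[u|a]|j0] /=.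
- split=> [->|[r [t [j [[-> ->] ->]]]]]; last by rewrite line_pt0.
  by exists (s u), 0, ord0; rewrite line_pt0.
- have sa := s_lt_succ a; split.
    case=> t /= /andP[t0 t1] <-; rewrite path_pt_convex ?ltW ?t0 //.
    exists (s a + t * (s a.+1 - s a)), 0, ord0; rewrite line_pt0; split=> //.
    by split=> //; apply/andP; split; nra.
  move=> [r [t [j [[/andP[ar ra] ->] ->]]]]; rewrite line_pt0.
  have d0 : 0 < s a.+1 - s a by lra.
  exists ((r - s a) / (s a.+1 - s a)) => /=.
    by rewrite divr_gt0 ?ltr_pdivrMr //; lra.
  rewrite path_pt_convex ?divfK ?gt_eqF //; first by congr path_pt; lra.
  by rewrite divr_ge0 ?ler_pdivrMr //; lra.
- split.
    case=> t /= t0 <-; exists (s (f j0)), t, j0; split=> //.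
    exact: offset_ray.
  move=> [r [t [j [[-> t0 ->] ->]]]]; exists t => //=.
  exact: offset_ray.
Qed.

Lemma locus_admissible (k : stratum) r t j : locus k r t j -> admissible r t j.
Proof.
case: k => [[u|a]|j'] /=.
- move=> [-> ->]; have := ltn_ord u => um; split; rewrite ?lexx ?ltxx //.
  by rewrite !s_le //; lia.
- move=> [/andP[ar ra] ->]; have := ltn_ord a => am; split; rewrite ?ltxx //.
  have s0a : s 0 <= s a by rewrite s_le //; lia.
  have sam : s a.+1 <= s m by rewrite s_le.
  by apply/andP; split; lra.
- move=> [-> t0 ->]; have := ltn_ord (f j') => fm; split=> //; last exact: ltW.
  by rewrite !s_le //; lia.
Qed.

Lemma admissible_locus r t j : admissible r t j -> exists k : stratum, locus k r t j.
Proof.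
move=> [/andP[r0 rm] t0 rj]; have [t_gt0|t_le0] := ltP 0 t.
  by exists (inr j); split=> //; apply: rj.
have {t_le0 t0 rj} -> : t = 0 by lra.
have ex0 : exists a, (a <= m)%N && (s a <= r) by exists 0%N.
have bnd a : (a <= m)%N && (s a <= r) -> (a <= m)%N by case/andP.
case: (ex_maxnP ex0 bnd) => a /andP[am sar] amax.
have [sa|sa] := eqVneq (s a) r.
  by exists (inl (inl (Ordinal (am : (a < m.+1)%N)))); rewrite /= sa.
have {}am : (a < m)%N.
  rewrite ltn_neqAle am andbT; apply/eqP => ea.
  by move/eqP: sa; apply; apply/eqP; rewrite eq_le sar ea.
exists (inl (inr (Ordinal am))); split=> //=.
rewrite lt_neqAle sa sar ltNge /=; apply/negP => sa1.
by have := amax a.+1; rewrite am sa1 ltnn => /(_ isT).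
Qed.

(** The parameters determine the cell, since no breakpoint lies strictly between
   two consecutive ones. *)
Lemma locus_unique (k k' : stratum) r t j j' :
  locus k r t j -> locus k' r t j' -> (0 < t -> j = j') -> k = k'.
Proof.
have s_gap (a b : nat) : (a <= m)%N -> (b < m)%N -> s b < s a < s b.+1 -> False.
  by move=> am bm; rewrite !s_lt //; lia.
have s_inj a b : (a <= m)%N -> (b <= m)%N -> s a = s b -> a = b.
  by move=> am bm e; apply/eqP; rewrite eqn_leq -(s_le am bm) -(s_le bm am) e lexx.
case: k => [[u|a]|i]; case: k' => [[v|b]|i'] /=.
- move=> [-> _] [e _] _; congr (inl (inl _)); apply: val_inj.
  by apply: s_inj e; rewrite -ltnS.
- move=> [-> _] [e _] _; case: (@s_gap u b) => //; by rewrite -ltnS.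
- by move=> [_ ->] [_]; rewrite ltxx.
- move=> [e _] [er _] _; case: (@s_gap v a) => //; [by rewrite -ltnS | by rewrite -er].
- move=> [/andP[ar ra] _] [/andP[br rb] _] _; congr (inl (inr _)); apply: val_inj.
  have := lt_trans ar rb; have := lt_trans br ra.
  have := ltn_ord a; have := ltn_ord b; move=> bm am /=.
  by rewrite !s_lt //; lia.
- by move=> [_ ->] [_]; rewrite ltxx.
- by move=> [_ t0 _] [_ e]; rewrite e ltxx in t0.
- by move=> [_ t0 _] [_ e]; rewrite e ltxx in t0.
- by move=> [_ t0 ->] [_ _ ->] /(_ t0) ->.
Qed.

Lemma open_cellsE X :
  open_cells line_tree X <-> exists k : stratum, X = stratum_set k.
Proof.
split.
  case=> [[[u _ <-]|[[u v] /= uv <-]]|[j _ <-]].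
  - by exists (inl (inl u)).
  - have lt_u := ltn_ord u; have lt_v := ltn_ord v.
    case/orP: uv => /eqP uv.
      have am : (u < m)%N by lia.
      by exists (inl (inr (Ordinal am))); rewrite /= uv.
    have am : (v < m)%N by lia.
    by exists (inl (inr (Ordinal am))); rewrite open_segment_sym /= uv.
  - by exists (inr j).
move=> [[[u|a]|j] ->].
- by left; left; exists u.
- have am := ltn_ord a; have a1 : (a < m.+1)%N by lia.
  left; right; exists (Ordinal a1, Ordinal (am : (a.+1 < m.+1)%N)) => //=.
  by rewrite eqxx.
- by right; exists j.
Qed.

Lemma line_tree_structure (p : tpoint R n.+1) (c0 : R) :
  (forall i, rep p i 0 = rep q i 0 + h i + c0) ->
  tree_structure line_tree (stable_line p q).
Proof.
move=> ph; split.
- exact: path_tree_is_tree.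
- move=> u; have [j fj /andP[j0 j1]] := f_surj u.
  exact: (path_tree_degree_ge3 _ f_cmin f_cmax cmin_cmax fj j0 j1).
- move=> u v /= e; apply/val_inj/eqP.
  have inS (w : 'I_m.+1) : locus (inl (inl w)) (s w) 0 ord0 by [].
  move: e; rewrite -!(line_pt0 _ ord0) => /eq_offset[c e].
  have [e1 _ _] := bend_inj (locus_admissible (inS u)) (locus_admissible (inS v)) e.
  have := locus_unique (inS u); rewrite e1 => /(_ _ _ (inS v)) H.
  by have [->] := H (fun=> erefl).
- move=> X Y /open_cellsE[k ->] /open_cellsE[k' ->] [x []].
  move=> /stratum_setP[r [t [j [Lk ->]]]] /stratum_setP[r' [t' [j' [Lk' /eq_offset[c e]]]]].
  have [er et ej] := bend_inj (locus_admissible Lk) (locus_admissible Lk') e.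
  by rewrite -er -et in Lk'; rewrite (locus_unique Lk Lk' ej).
- apply/seteqP; split=> x.
    move=> [X /open_cellsE[k ->] /stratum_setP[r [t [j [Lk ->]]]]].
    by apply/(stable_line_bend ph); exists r, t, j; split=> //; apply: locus_admissible Lk.
  move=> /(stable_line_bend ph)[r [t [j [adm ->]]]].
  have [k Lk] := admissible_locus adm.
  exists (stratum_set k); first by apply/open_cellsE; exists k.
  by apply/stratum_setP; exists r, t, j.
Qed.

(** * Balancing, distances and closest vertices *)

(** From [s a] to [s a.+1] exactly the coordinates of the leaves attached at or
   before [a] increase, all by the same amount. *)
Definition edge_dir (a : nat) : 'cV[int]_n :=
  class_of (fun i => (f i <= a)%:R : int).

Lemma path_pt_step (a : nat) : (a < m)%N ->
  path_pt (s a.+1) - path_pt (s a) =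
  (s a.+1 - s a) *: map_mx intr (edge_dir a).
Proof.
move=> am; have sa := s_lt_succ (Ordinal am); rewrite /= in sa.
rewrite offset_sub; apply/colP => j; rewrite !mxE rmorphB /= !mulrz_nat.
rewrite !(max_between _ am (r := s a.+1)) ?(ltW sa) ?lexx //.
ring.
Qed.

Lemma edge_dir_top : edge_dir m = 0.
Proof. by apply: (class_of0 (c := 1)) => i; rewrite -ltnS ltn_ord. Qed.

(** There is no edge beyond the last vertex, which agrees with [edge_dir m] being
   the class of the all-ones vector. *)
Lemma sum_up_edges u :
  \sum_(v : 'I_m.+1 | u.+1 == v :> nat) edge_dir u = edge_dir u.
Proof.
have [um|mu] := ltnP u m.
  rewrite (big_pred1 (inord u.+1)) // => v.
  by rewrite /= -val_eqE /= inordK // eq_sym.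
rewrite big_pred0 => [|v]; last by have := ltn_ord v; lia.
by rewrite (_ : nat_of_ord u = m) ?edge_dir_top //; have := ltn_ord u; lia.
Qed.

Lemma sum_down_edges u :
  \sum_(v : 'I_m.+1 | v.+1 == u :> nat) - edge_dir v =
  - class_of (fun i => (f i < u)%N%:R : int).
Proof.
have [u0|u0] := posnP u.
  rewrite big_pred0 => [|v]; last by rewrite u0.
  by rewrite (class_of0 (c := 0)) ?oppr0 // => i; rewrite u0.
have um := ltn_ord u.
rewrite (big_pred1 (inord u.-1)) => [|v]; last first.
  by rewrite /= -val_eqE /= inordK; lia.
rewrite inordK; last by lia.
congr (- _); apply/colP => j; rewrite !mxE.
by congr (_%:R - _%:R); congr (nat_of_bool _); lia.
Qed.

Lemma sum_unit_classes (P : pred 'I_n.+1) :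
  \sum_(j | P j) - class_of (fun i => (i == j)%:R : int) =
  - class_of (fun i => (P i)%:R).
Proof.
rewrite sumrN; congr (- _); apply/colP => k; rewrite summxE !mxE.
have sumE i : \sum_(j | P j) (i == j)%:R = (P i)%:R :> int.
  rewrite big_mkcond (bigD1 i) //= eqxx big1 ?addr0; first by case: (P i).
  by move=> j /negPf; rewrite eq_sym => ->; case: ifP.
by rewrite -!sumE -sumrB; apply: eq_bigr => j _; rewrite mxE.
Qed.

(** With edge directions written through the leaf map, balancing at [u] is the
   identity [[f <= u] - [f < u] - [f = u] = 0]. *)
Lemma line_tree_balanced : balanced line_tree.
Proof.
move=> u.
exists (fun v : 'I_m.+1 => if u.+1 == v :> nat then edge_dir u else - edge_dir v).
exists (fun j => - class_of (fun i => (i == j)%:R : int)).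
have below (a : nat) : (a < m)%N -> (f cmin <= a)%N && ~~ (f cmax <= a)%N.
  by rewrite f_cmin f_cmax /= -ltnNge => ->.
have prim1 (a : nat) (e : int) : (a < m)%N -> `|e|%N = 1%N ->
    \big[gcdn/0%N]_(i < n) `|(e *: edge_dir a) i 0%R|%N = 1%N.
  move=> /below/andP[fmin fmax] e1.
  exact: (@primitive_class n (fun i => (f i <= a)%N) _ _ e fmin fmax e1).
split.
- move=> v /= uv; have ltu := ltn_ord u; have ltv := ltn_ord v.
  case: eqP uv => [uv _|_ /= /eqP vu].
    have um : (u < m)%N by lia.
    rewrite -uv; split; first by have := prim1 u 1 um erefl; rewrite scale1r.
    exists (s u.+1 - s u); last exact: path_pt_step.
    by rewrite subr_gt0 s_lt //; lia.
  have vm : (v < m)%N by lia.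
  rewrite -vu; split; first by have := prim1 v (-1) vm erefl; rewrite scaleN1r.
  exists (s v.+1 - s v); first by rewrite subr_gt0 s_lt //; lia.
  by rewrite -opprB path_pt_step // map_mxN scalerN.
- move=> j fj; split.
    rewrite -scaleN1r.
    have [b bj] : exists b, b != j.
      have [->|] := eqVneq j cmin; last by exists cmin; rewrite eq_sym.
      by exists cmax; rewrite eq_sym.
    exact: (@primitive_class n (fun i => i == j) j b (-1) (eqxx j) bj erefl).
  exists 1 => //; rewrite scale1r ray_dirE; apply/colP => k; rewrite !mxE.
  by rewrite rmorphN rmorphB /= !mulrz_nat; ring.
- rewrite sum_unit_classes (bigID (fun v : 'I_m.+1 => u.+1 == v :> nat)) /=.
  rewrite [X in X + _ + _](_ : _ = edge_dir u); last first.
    rewrite -[RHS]sum_up_edges.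
    by apply: eq_big => v; case: eqP; rewrite ?andbF.
  rewrite [X in _ + X + _](_ : _ = - class_of (fun i => (f i < u)%N%:R : int)); last first.
    rewrite -sum_down_edges; apply: eq_big => v.
      by case: eqP => [<-|_]; rewrite ?andbF ?andbT //=; apply/esym/eqP; lia.
    by case/andP=> _ /negPf->.
  apply/colP => k; rewrite !mxE.
  have split_le i : (f i <= u)%:R = (f i < u)%N%:R + (f i == u)%:R :> int.
    by rewrite -val_eqE /= leq_eqVlt; case: ltngtP.
  by rewrite !split_le; ring.
Qed.

Lemma line_tree_tconv (p : tpoint R n.+1) (c0 : R) :
  (forall i, rep p i 0 = rep q i 0 + h i + c0) ->
  forall u, tconv p q (path_pt (s u)).
Proof.
move=> ph u; right; exists (- c0), (s u).
exists (Num.max (h ord_max) (s u)) => i.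
rewrite [LHS]mxE rep_offset ph.
rewrite (_ : - c0 + _ = h i + rep q i 0); last by lra.
by rewrite -addr_maxl; lra.
Qed.

(** Between two points of the path the coordinate [cmax] does not move at all and
   [cmin] moves by the full change of the parameter. *)
Lemma tdist_path r r' : h cmin <= r -> r <= r' -> r' <= h cmax ->
  tdist (path_pt r) (path_pt r') = r' - r.
Proof.
move=> r0 rr' r1; rewrite tdist_sym.
apply: (@tdist_osc _ _ _ _ (fun i => Num.max (h i) r' - Num.max (h i) r)
  (Num.max (h ord_max) r - Num.max (h ord_max) r') _ cmax cmin).
- by move=> i; rewrite !rep_offset; lra.
- move=> i; case: (leP (h i) r') => hr'; case: (leP (h i) r) => hr;
    by apply/andP; split; lra.
- by rewrite !max_l ?subrr // (le_trans rr').
- by rewrite !max_r // (le_trans r0).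
Qed.

Lemma path_pt_q : path_pt (h cmax) = q.
Proof.
apply: eq_rep => i.
by rewrite rep_offset (max_r (h_le i)) (max_r (h_le _)) addrK.
Qed.

Lemma path_pt_p (p : tpoint R n.+1) (c0 : R) :
  (forall i, rep p i 0 = rep q i 0 + h i + c0) -> path_pt (h cmin) = p.
Proof.
move=> ph; symmetry; apply: (@offset_eqP _ _ _ _ _ c0) => i.
by rewrite ph (max_l (h_ge i)).
Qed.

Lemma s_between (a : nat) : (a <= m)%N -> h cmin <= s a <= h cmax.
Proof.
rewrite -ltnS => am; have [j + _] := h_surj (Ordinal am).
by rewrite /= => <-; rewrite h_ge h_le.
Qed.

Section WithP.
Variables (p : tpoint R n.+1) (c0 : R).
Hypothesis ph : forall i, rep p i 0 = rep q i 0 + h i + c0.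

Lemma tdist_p_path a : (a <= m)%N -> tdist p (path_pt (s a)) = s a - h cmin.
Proof.
by move=> /s_between/andP[s0 s1]; rewrite -(path_pt_p ph) tdist_path.
Qed.

Lemma tdist_p_q : tdist p q = h cmax - h cmin.
Proof. by rewrite -(path_pt_p ph) -{1}path_pt_q tdist_path. Qed.

Lemma closest_vertex_p (v : tvert line_tree) : closest_vertex p v <-> v = ord0.
Proof.
have leq_m (u : 'I_m.+1) : (u <= m)%N by rewrite -ltnS.
split=> [/(_ ord0)|-> w] /=; rewrite !tdist_p_path ?leq_m // lerD2r s_le //.
by rewrite leqn0 => /eqP v0; apply: val_inj.
Qed.

End WithP.

Lemma tdist_q_path a : (a <= m)%N -> tdist q (path_pt (s a)) = h cmax - s a.
Proof.
by move=> /s_between/andP[s0 s1]; rewrite -{1}path_pt_q tdist_sym tdist_path.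
Qed.

Lemma closest_vertex_q (v : tvert line_tree) : closest_vertex q v <-> v = ord_max.
Proof.
have leq_m (u : 'I_m.+1) : (u <= m)%N by rewrite -ltnS.
split=> [/(_ ord_max)|-> w] /=; rewrite !tdist_q_path ?leq_m // lerD2l lerN2 s_le //.
by move=> mv; apply/val_inj/eqP; rewrite eqn_leq leq_m.
Qed.

End BentPath.

(** * The tree read off from the coordinate differences *)

Section Breakpoints.
Variables (R : realType) (n : nat) (cmax cmin : 'I_n.+1) (h : 'I_n.+1 -> R).

(** The values at [cmin] and [cmax] are left out: they are the parameters of [p]
   and [q], which are vertices only if another leaf shares the value. *)
Definition breakpoints : seq R :=
  sort <=%O (undup [seq h i | i <- enum 'I_n.+1 & (i != cmin) && (i != cmax)]).

Definition spine_length : nat := (size breakpoints).-1.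

Definition leaf_pos (j : 'I_n.+1) : 'I_spine_length.+1 :=
  if j == cmax then ord_max else if j == cmin then ord0
  else inord (index (h j) breakpoints).

Hypothesis cmin_cmax : cmin != cmax.
Hypothesis third : exists k, (k != cmin) && (k != cmax).

Lemma mem_breakpoints r :
  reflect (exists2 j, (j != cmin) && (j != cmax) & h j = r) (r \in breakpoints).
Proof.
rewrite mem_sort mem_undup; apply: (iffP mapP) => [[j]|[j jc <-]].
  by rewrite mem_filter => /andP[jc _] ->; exists j.
by exists j; rewrite // mem_filter jc mem_enum.
Qed.

Lemma size_breakpoints : size breakpoints = spine_length.+1.
Proof.
have [k kc] := third; have : h k \in breakpoints by apply/mem_breakpoints; exists k.
by rewrite /spine_length; case: breakpoints.
Qed.

Lemma breakpoints_lt a b : (a <= spine_length)%N -> (b <= spine_length)%N ->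
  (breakpoints`_a < breakpoints`_b) = (a < b)%N.
Proof.
move=> am bm; apply: lt_sorted_ltn_nth; rewrite ?inE ?size_breakpoints //.
by rewrite sort_lt_sorted undup_uniq.
Qed.

Lemma leaf_pos_cmax : leaf_pos cmax = ord_max.
Proof. by rewrite /leaf_pos eqxx. Qed.

Lemma leaf_pos_cmin : leaf_pos cmin = ord0.
Proof. by rewrite /leaf_pos (negPf cmin_cmax) eqxx. Qed.

Lemma h_leaf_pos j : j != cmin -> j != cmax -> h j = breakpoints`_(leaf_pos j).
Proof.
move=> j0 j1; rewrite /leaf_pos (negPf j0) (negPf j1).
have hj : h j \in breakpoints by apply/mem_breakpoints; exists j; rewrite ?j0.
by rewrite inordK ?nth_index // -size_breakpoints index_mem.
Qed.

Lemma leaf_pos_surj u : exists2 j, leaf_pos j = u & (j != cmin) && (j != cmax).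
Proof.
have us : (u < size breakpoints)%N by rewrite size_breakpoints.
have /mem_breakpoints[j jc hj] := mem_nth 0 us.
exists j => //; move: jc => /andP[j0 j1].
have hj' := h_leaf_pos j0 j1.
have lu : (u <= spine_length)%N by rewrite -ltnS.
have lj : (leaf_pos j <= spine_length)%N by rewrite -ltnS.
apply: val_inj; apply/eqP; rewrite eqn_leq /= [X in X && _]leqNgt [X in _ && X]leqNgt.
by rewrite -(breakpoints_lt lu lj) -(breakpoints_lt lj lu) -hj' hj ltxx.
Qed.

Definition tree_of (q : tpoint R n.+1) : embedded_tree R n.+1 :=
  line_tree h (nth 0 breakpoints) leaf_pos q.

End Breakpoints.

(** * Generic pairs of points *)

Section Generic.
Variables (R : realType) (n : nat) (k l : 'I_n.+1).

(** [f_kl] as a linear form on pairs of points. *)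
Definition diff_form (x : tpoint R n.+1 * tpoint R n.+1) : R^o :=
  rep x.1 k 0 - rep x.2 k 0 - (rep x.1 l 0 - rep x.2 l 0).

Fact diff_form_is_linear : linear diff_form.
Proof.
move=> a x y; rewrite /diff_form /= !rep_add !rep_scale.
rewrite -[a *: _]/(a * _); ring.
Qed.
HB.instance Definition _ := GRing.isLinear.Build R
  (tpoint R n.+1 * tpoint R n.+1)%type R^o _ diff_form diff_form_is_linear.

Definition diff_hyperplane : {vspace (tpoint R n.+1 * tpoint R n.+1)%type} :=
  lker (linfun diff_form).

Lemma mem_diff_hyperplane x : (x \in diff_hyperplane) = (diff_form x == 0).
Proof. by rewrite memv_ker lfunE. Qed.

Lemma diff_hyperplane_proper : k != l -> diff_hyperplane != fullv.
Proof.
move=> /negPf kl; apply/eqP => full.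
have := memvf ((class_of (fun i => (i == k)%:R), 0) : tpoint R n.+1 * tpoint R n.+1).
have rep0 i : rep (0 : tpoint R n.+1) i 0 = 0.
  by rewrite -(scale0r 0) rep_scale mul0r.
rewrite -full mem_diff_hyperplane /diff_form /= !rep0 !rep_class_of.
rewrite eqxx (eq_sym l) kl.
set d := (ord_max == k)%:R.
by have -> : 1 - d - 0 - (0 - d - 0) = 1 :> R by [ring]; rewrite oner_eq0.
Qed.

End Generic.

Lemma normal_idempotent_le (R : realType) n (A : 'M[R]_n) i j k :
  normal_idempotent A -> A i k + A k j <= A i j.
Proof.
move=> [_ AA]; rewrite -{3}AA mxE; exact: (le_bigmax _ (fun k => A i k + A k j)).
Qed.

Lemma entry_of_abs_diff (R : realType) n (c1 c2 : 'I_n) (A : 'M[R]_n)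
    (h : 'I_n -> R) (c : R) (k l : 'I_n) :
  (forall i, h i = A i c1 - A i c2 + c) -> k != l ->
  entry_of_abs (Fmx c1 c2 A) `|h k - h l|.
Proof.
move=> hA; rewrite -val_eqE neq_ltn => /orP[] kl.
  by exists k, l; split=> //; rewrite mxE kl !hA; congr `|_|; lra.
by exists l, k; split=> //; rewrite mxE kl distrC !hA; congr `|_|; lra.
Qed.

Theorem theorem13 (R : realType) (n : nat) (hn : (3 <= n)%N)
    (c1 c2 : 'I_n) (hc1 : c1 = 0%N :> nat) (hc2 : c2 = 1%N :> nat) :
  exists (Phi : 'M[R]_n -> {set {set {set 'I_n}}})
         (Ws : seq {vspace (tpoint R n * tpoint R n)%type}),
    (forall W, W \in Ws -> W != fullv) /\
    forall (A : 'M[R]_n) (p q : tpoint R n),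
      normal_idempotent A ->
      p <> q ->
      represents (col c1 A) p ->
      represents (col c2 A) q ->
      let F := Fmx c1 c2 A in
      exists T : embedded_tree R n,
        [/\ [/\ tree_structure T (stable_line p q), balanced T, caterpillar T
              & splits T = Phi F],
            (forall v : tvert T, tconv p q (tpos v)),
            (exists! pq : tvert T, closest_vertex p pq) /\
            (exists! qp : tvert T, closest_vertex q qp),
            [/\ (forall u v : tvert T, tadj u v ->
                   entry_of_abs F (tdist (tpos u) (tpos v))),
                (forall pq : tvert T, closest_vertex p pq ->
                   entry_of_abs F (tdist p (tpos pq))),
                (forall qp : tvert T, closest_vertex q qp ->
                   entry_of_abs F (tdist (tpos qp) q))
              & entry_of_abs F (tdist p q)]
          & (forall W, W \in Ws -> (p, q) \notin W) -> trivalent T].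
Proof.
case: n hn c1 c2 hc1 hc2 => [|n] // hn c1 c2 hc1 hc2.
(* Modulo constants the first row of [F] is the negative of the coordinate
   difference of [p] and [q]; with the base point [0] instead of [q] the tree
   has other positions but the same splits. *)
exists (fun G => splits (tree_of c1 c2 (fun i => - G c1 i) 0)).
(* Pairs [p, q] with two equal coordinate differences. *)
exists [seq diff_hyperplane R e.1 e.2 | e <- enum {: 'I_n.+1 * 'I_n.+1} & e.1 != e.2].
split=> [W /mapP[[k l] + ->]|A p q NI _ [cp Ap] [cq Aq] F].
  by rewrite mem_filter /= => /andP[kl _]; apply: diff_hyperplane_proper.
have c21 : c2 != c1 by rewrite -val_eqE /= hc1 hc2.
have third : exists k : 'I_n.+1, (k != c2) && (k != c1).
  by exists (Ordinal hn); rewrite -!val_eqE /= hc1 hc2.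
pose h i := - F c1 i.
pose ch := - (A c1 c1 - A c1 c2).
have hA i : h i = A i c1 - A i c2 + ch.
  rewrite /h /F mxE hc1; have [i0|] := posnP (i : nat); last by rewrite /ch; lra.
  have -> : i = c1 by apply: val_inj; rewrite /= i0 hc1.
  by rewrite oppr0 /ch; lra.
have ph i : rep p i 0 = rep q i 0 + h i + (cq - cp - ch).
  by have := Ap i; have := Aq i; rewrite hA !mxE -!/(rep _ _ _); lra.
have [A0 _] := NI.1.
have h_ge i : h c2 <= h i.
  by have := normal_idempotent_le i c1 c2 NI; rewrite !hA !A0; lra.
have h_le i : h i <= h c1.
  by have := normal_idempotent_le i c2 c1 NI; rewrite !hA !A0; lra.
have f1 := leaf_pos_cmax c1 c2 h.
have f2 := leaf_pos_cmin h c21.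
have fsurj := leaf_pos_surj (h := h) third.
have hf := h_leaf_pos h third.
have slt := breakpoints_lt (h := h) third.
set s := nth 0 (breakpoints c1 c2 h) in hf slt.
exists (tree_of c1 c2 h q).
have entry k l : k != l -> entry_of_abs F `|h k - h l|.
  exact: entry_of_abs_diff hA.
have vertex (u : 'I_(spine_length c1 c2 h).+1) :
    exists2 j, h j = s u & [/\ j != c2, j != c1 & leaf_pos c1 c2 h j = u].
  exact: h_surj fsurj hf u.
split.
- split.
  + exact: line_tree_structure c21 f1 f2 fsurj hf h_ge h_le slt q p _ ph.
  + exact: line_tree_balanced c21 f1 f2 fsurj hf h_ge h_le slt q.
  + exact: path_tree_caterpillar.
  + by [].
- exact: line_tree_tconv ph.
- have cp_iff v := closest_vertex_p fsurj hf h_ge h_le slt ph v.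
  have cq_iff v := closest_vertex_q fsurj hf h_ge h_le slt (q := q) v.
  split.
    by exists ord0; split=> [|v /cp_iff->//]; apply/cp_iff.
  by exists ord_max; split=> [|v /cq_iff->//]; apply/cq_iff.
- split.
  + move=> u v /= uv; have [j hj [_ _ fj]] := vertex u.
    have [k hk [_ _ fk]] := vertex v.
    have jk : j != k by apply/eqP => jk; move: uv; rewrite -fj -fk jk; lia.
    have leq_m (w : 'I_(spine_length c1 c2 h).+1) : (w <= spine_length c1 c2 h)%N.
      by rewrite -ltnS.
    have /andP[su0 su1] := s_between fsurj hf h_ge h_le (leq_m u).
    have /andP[sv0 sv1] := s_between fsurj hf h_ge h_le (leq_m v).
    have -> : tdist (path_pt h q (s u)) (path_pt h q (s v)) = `|h j - h k|.
      rewrite hj hk; have [suv|/ltW svu] := leP (s u) (s v).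
        by rewrite (tdist_path (cmax := c1) (cmin := c2)) // distrC ger0_norm ?subr_ge0.
      by rewrite tdist_sym (tdist_path (cmax := c1) (cmin := c2)) // ger0_norm ?subr_ge0.
    exact: entry.
  + move=> v /(closest_vertex_p fsurj hf h_ge h_le slt ph)->.
    have [j hj [j0 _ _]] := vertex ord0.
    rewrite (tdist_p_path fsurj hf h_ge h_le ph) // -hj.
    by rewrite -(ger0_norm (x := _ - _)) ?subr_ge0 //; apply: entry.
  + move=> v /(closest_vertex_q fsurj hf h_ge h_le slt (q := q))->.
    have [j hj [_ j1 _]] := vertex ord_max.
    rewrite tdist_sym (tdist_q_path fsurj hf h_ge h_le) // -hj.
    by rewrite -(ger0_norm (x := _ - _)) ?subr_ge0 //; apply: entry; rewrite eq_sym.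
  + rewrite (tdist_p_q h_ge h_le ph).
    by rewrite -(ger0_norm (x := _ - _)) ?subr_ge0 //; apply: entry; rewrite eq_sym.
- move=> generic; apply: (path_tree_trivalent f2 f1 c21 fsurj) => j k j0 j1 k0 k1 fjk.
  apply/eqP/negPn/negP => jk.
  have /negP[] : (p, q) \notin diff_hyperplane R j k.
    apply: generic; apply/mapP; exists (j, k) => //.
    by rewrite mem_filter /= jk mem_enum.
  rewrite mem_diff_hyperplane /diff_form /= !ph.
  by rewrite (hf j) // (hf k) // fjk; apply/eqP; lra.
Qed.
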